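(* Let $L\ge2$, $m\ge1$, and let $f_m$ be the function represented by an $L$-layer neural network with width $m$, with parameters $z_i\in\mathbb{R}^d$, $W^{(l)}_{i,j}\in\mathbb{R}$, $a_i\in\mathbb{R}$ and pre-activation functions $h_i^{(l)}$. For every $p\in[2,\infty]$, $f_m\in\mathcal{F}^{(L)}_p$ with $$\mathscr{C}^{(L)}_p(f_m)\le\prod_{l=1}^{L}M^{(l)}_{m,p}.$$ In particular, $f_m$ belongs to the NHL $(\mathcal{H}^{(l)}_m)_{l\in[L]}$, where $\mathcal{H}^{(1)}_m:=\mathcal{H}^{(1)}$ and, for all $l\in[L-1]$, $\mathcal{H}^{(l+1)}_m:=\mathcal{H}_{\mu^{(l)}_m}$ with $\mu^{(l)}_m:=\frac1m\sum_{i=1}^m\delta_{h_i^{(l)}}\in\mathcal{P}(\mathcal{C})$.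
   Context: $[n]=\{1,\dots,n\}$. $\mathcal{X} \subset \mathbb{R}^d$ is compact; $\mathcal{C}$ is the space of continuous functions on $\mathcal{X}$ with the sup-norm and its Borel sigma-algebra; $\sigma:\mathbb{R}\to\mathbb{R}$ is a fixed activation function. $\mathcal{P}(U)$ is the set of probability measures on $U$. Network: $f_m(x)=\frac1m\sum_{i=1}^m a_i\,\sigma(h_i^{(L-1)}(x))$, where $h_i^{(1)}(x)=z_i^\top x$ and $h_i^{(l+1)}(x)=\frac1m\sum_{j=1}^m W^{(l)}_{i,j}\,\sigma(h_j^{(l)}(x))$ for $l\in[L-2]$, $i\in[m]$. Parameter norms, for $p\in[2,\infty]$: $M^{(1)}_{m,p}=\big(\frac1m\sum_i\|z_i\|_2^p\big)^{1/p}$; $M^{(l+1)}_{m,p}=\Big(\frac1m\sum_i\big(\frac1m\sum_j|W^{(l)}_{i,j}|^2\big)^{p/2}\Big)^{1/p}$ for $l\in[L-2]$; $M^{(L)}_{m,p}=\big(\frac1m\sum_i a_i^2\big)^{1/2}$; for $p=\infty$ these $p$-means are replaced by maxima over $i\in[m]$. For a probability measure $\mu$ on functions on $\mathcal{X}$ (e.g. $\mu\in\mathcal{P}(\mathcal{C})$), put $\kappa_\mu(x,x') = \int \sigma(h(x))\sigma(h(x'))\,\mu(dh)$ (assumed finite), and let $\mathcal{H}_\mu$ be the reproducing kernel Hilbert space (RKHS) on $\mathcal{X}$ with kernel $\kappa_\mu$. For an RKHS $\mathcal{H}$, $\mathcal{P}(\mathcal{H})$ denotes probability measures on functions on $\mathcal{X}$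 concentrated on $\mathcal{H}$; for $\mu\in\mathcal{P}(\mathcal{H})$, $\|\mu\|_{\mathcal{H},p} = (\int \|h\|_{\mathcal{H}}^p\,\mu(dh))^{1/p}$ for $0<p<\infty$, and $\|\mu\|_{\mathcal{H},\infty}$ is the $\mu$-essential supremum of $\|\cdot\|_{\mathcal{H}}$. $\mathcal{H}^{(1)} = \{x\mapsto z^\top x : z\in\mathbb{R}^d\}$ with the inner product inherited from $\mathbb{R}^d$ (the RKHS of the kernel $x^\top x'$). An $L$-level neural Hilbert ladder (NHL) is a sequence of RKHSs $(\mathcal{H}^{(l)})_{l\in[L]}$ on $\mathcal{X}$, starting with this $\mathcal{H}^{(1)}$, such that for each $l\in[L-1]$ there is $\mu^{(l)}\in\mathcal{P}(\mathcal{H}^{(l)})$ with $\mathcal{H}^{(l+1)}=\mathcal{H}_{\mu^{(l)}}$; $f$ belongs to the NHL if $f\in\mathcal{H}^{(L)}$. For RKHSs $\mathcal{H},\mathcal{H}'$ on $\mathcal{X}$: $\mathscr{D}_p(\mathcal{H},\mathcal{H}') = \inf\{\|\mu\|_{\mathcal{H},p} : \mu\in\mathcal{P}(\mathcal{H}),\ \mathcal{H}_\mu=\mathcal{H}'\}$. $\mathscr{D}^{(L)}_p(\mathcal{H}) = \inf_{\mathcal{H}^{(2)},\dots,\mathcal{H}^{(L-1)}} \prod_{l=1}^{L-1}\mathscr{D}_p(\mathcal{H}^{(l)},\mathcal{H}^{(l+1)})$ with $\mathcal{H}^{(L)}=\mathcal{H}$ and the infimum over RKHSs on $\mathcal{X}$.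 $\mathscr{C}^{(L)}_p(f) = \inf_{\mathcal{H}} \big(\|f\|_{\mathcal{H}}\cdot \mathscr{D}^{(L)}_p(\mathcal{H})\big)$ over RKHSs $\mathcal{H}$ on $\mathcal{X}$. Conventions: an infimum over the empty set is $+\infty$, and in products only choices with all factors finite are considered (in particular $f\in\mathcal{H}$). $\mathcal{F}^{(L)}_p = \{f : \mathscr{C}^{(L)}_p(f)<\infty\}$.
   Formalization: The side claim that each empirical measure lies in P(C) is stated only for continuous σ, since for discontinuous σ the pre-activations from layer 2 on need not be continuous; all other claims hold for arbitrary σ. *)

(* Defs.v *)
From HB Require Import structures.
From mathcomp Require Import all_boot all_order all_algebra.
From mathcomp Require Import all_classical all_reals all_analysis.

Set Implicit Arguments.
Unset Strict Implicit.
Unset Printing Implicit Defensive.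

Import Order.TTheory GRing.Theory Num.Theory.
Import numFieldNormedType.Exports.

Local Open Scope classical_set_scope.
Local Open Scope ring_scope.

(* A Hilbert space of real functions on [T] whose point evaluations are
   bounded.  Functions are total on [T]; the values of [rkhs_ip] outside
   [rkhs_fun] carry no information. *)
Record rkhs (R : realType) (T : Type) := Rkhs {
  rkhs_fun :> set (T -> R);
  rkhs_ip : (T -> R) -> (T -> R) -> R;
  rkhs_zero : rkhs_fun (fun=> 0);
  rkhs_lin : forall (c : R) f g, rkhs_fun f -> rkhs_fun g ->
    rkhs_fun (fun x => c * f x + g x);
  rkhs_ipC : forall f g, rkhs_fun f -> rkhs_fun g ->
    rkhs_ip f g = rkhs_ip g f;
  rkhs_ip_lin : forall (c : R) f g k,
    rkhs_fun f -> rkhs_fun g -> rkhs_fun k ->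
    rkhs_ip (fun x => c * f x + g x) k = c * rkhs_ip f k + rkhs_ip g k;
  rkhs_ip_ge0 : forall f, rkhs_fun f -> 0 <= rkhs_ip f f;
  rkhs_ip_eq0 : forall f, rkhs_fun f -> rkhs_ip f f = 0 -> f = (fun=> 0);
  rkhs_complete : forall u : nat -> T -> R, (forall n, rkhs_fun (u n)) ->
    (forall e : R, 0 < e -> exists N : nat, forall n k : nat,
       (N <= n)%N -> (N <= k)%N ->
       Num.sqrt (rkhs_ip (u n \- u k) (u n \- u k)) < e) ->
    exists2 f, rkhs_fun f &
      Num.sqrt (rkhs_ip (u n \- f) (u n \- f)) @[n --> \oo] --> (0 : R);
  rkhs_eval : forall x : T, exists c : R, forall f, rkhs_fun f ->
    `|f x| <= c * Num.sqrt (rkhs_ip f f)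
}.

Definition rkhs_norm (R : realType) (T : Type) (H : rkhs R T)
  (f : T -> R) : R := Num.sqrt (rkhs_ip H f f).

(* By the Moore-Aronszajn theorem a kernel determines its RKHS, so this says
   that [H] is the RKHS with kernel [k]. *)
Definition has_kernel (R : realType) (T : Type) (H : rkhs R T)
    (k : T -> T -> R) : Prop :=
  (forall x, rkhs_fun H (k x)) /\
  (forall f x, rkhs_fun H f -> f x = rkhs_ip H f (k x)).

(* The sets of functions whose trace on [U] is open for the metric
   [N (g - f)] of [U]; what happens outside [U] is unconstrained. *)
Definition norm_opens (R : realType) (T : Type) (U : set (T -> R))
    (N : (T -> R) -> R) : set (set (T -> R)) :=
  [set A | forall f, A f -> U f ->
     exists2 e : R, 0 < e & forall g, U g -> N (g \- f) < e -> A g].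

(* All functions on [T], with the sigma-algebra of the sets whose trace on [U]
   is Borel in the normed space [(U, N)].  [U] itself is measurable, and the
   measures concentrated on [U] are exactly the Borel measures of [(U, N)]. *)
Definition funs_on (R : realType) (T : Type) (U : set (T -> R))
  (N : (T -> R) -> R) := g_sigma_algebraType (norm_opens U N).

HB.instance Definition _ (R : realType) (T : Type) (U : set (T -> R))
  (N : (T -> R) -> R) := Measurable.on (funs_on U N).

Definition fun_prob (R : realType) (T : Type) (U : set (T -> R))
    (N : (T -> R) -> R) : set {measure set (funs_on U N) -> \bar R} :=
  [set mu | mu setT = 1%E /\ mu (~` U) = 0%E].
Arguments fun_prob {R T} U N _.

Definition rkhs_prob (R : realType) (T : Type) (H : rkhs R T) :
    set {measure set (funs_on H (rkhs_norm H)) -> \bar R} :=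
  fun_prob H (rkhs_norm H).
Arguments rkhs_prob {R T} H _.

Section empirical.
Context (R : realType) (T : Type) (U : set (T -> R)) (N : (T -> R) -> R).
Context (m : nat) (h : 'I_m -> T -> R).
Local Open Scope ereal_scope.

Definition empirical (A : set (funs_on U N)) : \bar R :=
  (m%:R^-1)%:E * \sum_(i < m) \d_(h i : funs_on U N) A.

Let empirical0 : empirical set0 = 0.
Proof. by rewrite /empirical big1 ?mule0// => i _; rewrite measure0. Qed.

Let empirical_ge0 A : 0 <= empirical A.
Proof.
by rewrite mule_ge0 ?lee_fin ?invr_ge0 ?ler0n//; apply: sume_ge0.
Qed.

Let empirical_sigma_additive : semi_sigma_additive empirical.
Proof.
move=> F mF tF mUF; rewrite [X in _ --> X](_ : _ =
    lim ((fun n => \sum_(0 <= i < n) empirical (F i)) @ \oo)).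
  by apply: is_cvg_ereal_nneg_natsum => k _; exact: empirical_ge0.
rewrite nneseriesZl//; last by move=> k _; exact: sume_ge0.
congr (_ * _); rewrite nneseries_sum//.
by apply: eq_bigr => /= i _; exact: measure_semi_bigcup.
Qed.

HB.instance Definition _ := isMeasure.Build _ _ _ empirical
  empirical0 empirical_ge0 empirical_sigma_additive.

End empirical.
Arguments empirical {R T} U N {m} h A.

Section ladder.
Context (R : realType) (T : Type) (sigma : R -> R).

Definition ladder_kernel (U : set (T -> R)) (N : (T -> R) -> R)
    (mu : {measure set (funs_on U N) -> \bar R}) (x x' : T) : R :=
  \int[mu]_h (sigma (h x) * sigma (h x')).

(* Integrability with respect to the completion of [mu]: no measurability of
   [sigma] is presupposed.  The library integral does not change on null sets,
   so [ladder_kernel mu x x'] is then the integral of [g]. *)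
Definition ladder_kernel_finite (U : set (T -> R)) (N : (T -> R) -> R)
    (mu : {measure set (funs_on U N) -> \bar R}) : Prop :=
  forall x x' : T, exists2 g : funs_on U N -> R,
    mu.-integrable [set: funs_on U N] (EFin \o g) &
    {ae mu, forall h : funs_on U N, sigma (h x) * sigma (h x') = g h}.

Definition is_ladder_rkhs (U : set (T -> R)) (N : (T -> R) -> R)
    (mu : {measure set (funs_on U N) -> \bar R}) (H : rkhs R T) : Prop :=
  ladder_kernel_finite mu /\ has_kernel H (ladder_kernel mu).

Definition rkhs_pnorm (p : \bar R) (H : rkhs R T)
    (mu : {measure set (funs_on H (rkhs_norm H)) -> \bar R}) : \bar R :=
  'N[mu]_p[EFin \o rkhs_norm H]%E.
Arguments rkhs_pnorm p {H} mu.

Definition level_dist (p : \bar R) (H H' : rkhs R T) : \bar R :=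
  ereal_inf [set rkhs_pnorm p mu |
    mu in [set mu | rkhs_prob H mu /\ is_ladder_rkhs mu H']].

End ladder.

Section complexity.
Context (R : realType) (d : nat) (X : set 'rV[R]_d) (sigma : R -> R).

Definition dotv (z x : 'rV[R]_d) : R := \sum_(k < d) z 0 k * x 0 k.

Definition norm2 (z : 'rV[R]_d) : R := Num.sqrt (dotv z z).

(* When [X] does not span R^d the vector [z] representing a function is not
   unique; the inner product inherited from R^d is the one fixed by the
   kernel. *)
Definition is_linear_rkhs (H : rkhs R X) : Prop :=
  rkhs_fun H = [set f | exists z, f = fun x : X => dotv z (set_val x)] /\
  has_kernel H (fun x x' : X => dotv (set_val x) (set_val x')).

(* Only the entries [Hs 1, ..., Hs L] matter. *)
Definition is_NHL (L : nat) (Hs : nat -> rkhs R X) : Prop :=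
  is_linear_rkhs (Hs 1%N) /\
  forall l : nat, (1 <= l < L)%N ->
    exists2 mu, rkhs_prob (Hs l) mu & is_ladder_rkhs sigma mu (Hs l.+1).

(* [level_dist] is nonnegative, so "finite" means [< +oo]. *)
Definition ladder_dist (L : nat) (p : \bar R) (H : rkhs R X) : \bar R :=
  ereal_inf [set (\prod_(1 <= l < L) level_dist sigma p (Hs l) (Hs l.+1))%E |
     Hs in [set Hs : nat -> rkhs R X |
        [/\ is_linear_rkhs (Hs 1%N), Hs L = H &
            forall l : nat, (1 <= l < L)%N ->
              level_dist sigma p (Hs l) (Hs l.+1) \is a fin_num]]].

Definition complexity (L : nat) (p : \bar R) (f : X -> R) : \bar R :=
  ereal_inf [set ((rkhs_norm H f)%:E * ladder_dist L p H)%E |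
    H in [set H : rkhs R X | rkhs_fun H f /\ ladder_dist L p H \is a fin_num]].

Definition complexity_space (L : nat) (p : \bar R) : set (X -> R) :=
  [set f | (complexity L p f < +oo)%E].

Definition cont_funs : set (X -> R) := [set f | continuous f].

Definition sup_norm (f : X -> R) : R := sup (range (fun x => `|f x|)).

End complexity.
Arguments cont_funs {R d} X _.
Arguments sup_norm {R d X} f.

Section network.
Context (R : realType) (d : nat) (X : set 'rV[R]_d) (sigma : R -> R).
Context (L m : nat) (z : 'I_m -> 'rV[R]_d) (W : nat -> 'I_m -> 'I_m -> R).
Context (a : 'I_m -> R).

(* Layers are numbered from 1; layer 0 is a dummy.  Only [W 1, ..., W (L - 2)]
   are used below layer [L]. *)
Fixpoint preact (l : nat) (i : 'I_m) (x : X) : R :=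
  if l is l'.+1 then
    if l' == 0%N then dotv (z i) (set_val x)
    else m%:R^-1 * \sum_(j < m) W l' i j * sigma (preact l' j x)
  else 0.

Definition network (x : X) : R :=
  m%:R^-1 * \sum_(i < m) a i * sigma (preact L.-1 i x).

Definition pmean (p : \bar R) (v : 'I_m -> R) : R :=
  if p is r%:E then (m%:R^-1 * \sum_(i < m) v i `^ r) `^ r^-1
  else \big[Num.max/0]_(i < m) v i.

Definition param_norm (p : \bar R) (l : nat) : R :=
  if l == 1%N then pmean p (fun i => norm2 (z i))
  else if l == L then Num.sqrt (m%:R^-1 * \sum_(i < m) a i ^+ 2)
  else pmean p (fun i =>
         Num.sqrt (m%:R^-1 * \sum_(j < m) `|W l.-1 i j| ^+ 2)).

Definition empirical_level (l : nat) :
    {measure set (funs_on (cont_funs X) sup_norm) -> \bar R} :=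
  empirical (cont_funs X) sup_norm (preact l).

Definition is_network_ladder (Hs : nat -> rkhs R X) : Prop :=
  is_linear_rkhs (Hs 1%N) /\
  forall l : nat, (1 <= l < L)%N ->
    is_ladder_rkhs sigma (empirical_level l) (Hs l.+1).

End network.

(* Main.v *)
(* Each [h_i^(l+1)] is a combination of the [m] functions [sigma \o h_j^(l)],
   and these are, up to the factor [m^(-1/2)], the coordinates of a feature map
   whose inner products give the kernel of the empirical measure of the
   [h_j^(l)].  In the RKHS of a kernel [<Phi x, Phi x'>] the function
   [x |-> <w, Phi x>] has norm at most [|w|] (project [w] on the span of the
   [Phi x]), which bounds [h_i^(l+1)] and the output by the norms of their
   weights.  Hence the [p]-norm of each empirical measure is at most
   [M^(l)_p].  As [sigma] need not be measurable, all integrals are computed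
   from the fact that points are measurable, so that an empirical measure
   only sees its finitely many atoms. *)

Require Import Defs.
From HB Require Import structures.
From mathcomp Require Import all_boot all_order all_algebra.
From mathcomp Require Import all_classical all_reals all_analysis.
From mathcomp Require Import measurable_realfun simple_functions ess_sup_inf.
Import Order.TTheory GRing.Theory Num.Theory.
Import numFieldNormedType.Exports HBNNSimple.
Local Open Scope classical_set_scope.
Local Open Scope ring_scope.
Set Implicit Arguments.
Unset Strict Implicit.
Unset Printing Implicit Defensive.

(** * Measures with finitely many atoms *)

Section finite_support.
Context d (T : measurableType d) (R : realType) (mu : {measure set T -> \bar R}).
Context (m : nat) (h : 'I_m -> T) (c : R).
Hypothesis c_ge0 : 0 <= c.
Local Open Scope ereal_scope.
Hypothesis muE : forall A, mu A = c%:E * \sum_(i < m) \d_(h i) A.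
Hypothesis mh : forall i, measurable [set h i].

Let S := range h.

Lemma measurable_image_atoms (P : set 'I_m) : measurable (h @` P).
Proof.
rewrite [X in measurable X](_ : _ = \bigcup_(i in P) [set h i]).
  by apply: fin_bigcup_measurable => // i _; exact: mh.
by apply/seteqP; split => x [i Pi] => [<-|->]; exists i.
Qed.

(** The set where [P] fails may be non-measurable, but it lies in the complement of the atoms, which
    is measurable and null. *)
Lemma atoms_ae (P : T -> Prop) : (forall i, P (h i)) -> {ae mu, forall x, P x}.
Proof.
move=> Ph; exists (~` S); split.
- exact/measurableC/measurable_image_atoms.
- rewrite muE big1 ?mule0// => i _.
  by rewrite diracE memNset//= => -[]; exists i.
- by move=> x nPx [i _ hx]; apply: nPx; rewrite -hx.
Qed.

(** Every set of atoms is a finite union of measurable points, so every preimage inside [S] is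
    measurable. *)
Lemma measurable_fun_atoms d' (T' : measurableType d') (f : T -> T') :
  measurable_fun S f.
Proof.
move=> _ Y _.
rewrite (_ : _ `&` _ = h @` [set i | Y (f (h i))]).
  exact: measurable_image_atoms.
by apply/seteqP; split => x /= [] => [[i _ <-]|i Yf <-]; [exists i|split=>//; exists i].
Qed.

Lemma measurable_restrict_atoms (f : T -> \bar R) : measurable_fun [set: T] (f \_ S).
Proof.
apply/(measurable_restrictT f (measurable_image_atoms setT))/measurable_fun_atoms.
Qed.

Lemma restrict_atoms (f : T -> \bar R) i : (f \_ S) (h i) = f (h i).
Proof. by rewrite patchE mem_set//; exists i. Qed.

Lemma ge0_integral_atoms_measurable (f : T -> \bar R) :
  measurable_fun [set: T] f -> (forall x, 0 <= f x) ->
  \int[mu]_x f x = c%:E * \sum_(i < m) f (h i).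
Proof.
(* [msum] is indexed by natural numbers, so [h] is extended by [point]; only the indices below [m]
   enter the sum. *)
move=> mf f0; pose h' k := oapp h point (insub k : option 'I_m).
pose nu := mscale (NngNum c_ge0) (msum (fun k => \d_(h' k)) m).
have h'E (i : 'I_m) : h' i = h i by rewrite /h' valK.
rewrite (@eq_measure_integral _ _ _ _ nu); last first.
  move=> A mA _; rewrite muE /nu /= /mscale /= /msum; congr (_ * _).
  by apply: eq_bigr => i _; rewrite h'E.
rewrite /nu ge0_integral_mscale//; congr (_ * _).
rewrite ge0_integral_measure_sum//; apply: eq_bigr => i _.
by rewrite integral_dirac// diracT mul1e h'E.
Qed.

(* No measurability: a simple function below [f] is bounded on the atoms, and
   the restriction of [f] to the atoms is measurable. *)
Lemma ge0_integral_atoms (f : T -> \bar R) : (forall x, 0 <= f x) ->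
  \int[mu]_x f x = c%:E * \sum_(i < m) f (h i).
Proof.
move=> f0; apply/eqP; rewrite eq_le; apply/andP; split.
  rewrite ge0_integralTE//; apply: ge_ereal_sup => _ [s /= sf <-].
  rewrite -integralT_nnsfun ge0_integral_atoms_measurable//.
  - by apply: lee_wpmul2l; [rewrite lee_fin|apply: lee_sum => i _; exact: sf].
  - exact/measurable_EFinP/measurable_funPT.
  - by move=> x; rewrite lee_fin.
have g0 x : 0 <= (f \_ S) x by rewrite patchE; case: ifPn.
under eq_bigr do rewrite -restrict_atoms.
rewrite -ge0_integral_atoms_measurable//; last exact: measurable_restrict_atoms.
rewrite !ge0_integralTE//; apply: ereal_sup_le => _ [s /= sf <-].
exists s => //= x; apply: le_trans (sf x) _.
by rewrite patchE; case: ifPn.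
Qed.

Lemma integral_atoms (f : T -> R) :
  \int[mu]_x (f x)%:E = (c * \sum_(i < m) f (h i))%:E.
Proof.
have E (g : T -> R) : (forall x, (0 <= g x)%R) ->
    \int[mu]_x (g x)%:E = (c * \sum_(i < m) g (h i))%:E.
  by move=> g0; rewrite ge0_integral_atoms ?sumEFin// => x; rewrite lee_fin.
rewrite integralE.
have -> : (fun x => (f x)%:E)^\+ = EFin \o (fun x => Num.max (f x) 0%R).
  by apply/funext => x; rewrite funeposE -EFin_max.
have -> : (fun x => (f x)%:E)^\- = EFin \o (fun x => Num.max (- f x)%R 0%R).
  by apply/funext => x; rewrite funenegE -EFinN -EFin_max.
rewrite !E; [|by move=> x; rewrite le_max lexx orbT..].
rewrite -EFinB -mulrBr -sumrB; congr (_ * _)%:E.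
apply: eq_bigr => i _.
have [f0|f0] := leP 0%R (f (h i)).
  by rewrite max_r ?subr0// oppr_le0.
by rewrite max_l ?sub0r ?opprK// oppr_ge0 ltW.
Qed.

(** The witness is [f] set to 0 off the atoms: it is measurable, its integral is a finite sum, and
    it agrees with [f] almost everywhere. *)
Lemma ae_integrable_atoms (f : T -> R) :
  exists2 g : T -> R, mu.-integrable [set: T] (EFin \o g) &
    {ae mu, forall x, f x = g x}.
Proof.
exists (f \_ S); last by apply: atoms_ae => i; rewrite patchE mem_set//; exists i.
apply/integrableP; split.
  rewrite (_ : EFin \o _ = (EFin \o f) \_ S); last first.
    by apply/funext => x /=; rewrite !patchE; case: ifP.
  exact: measurable_restrict_atoms.
rewrite ge0_integral_atoms//.
rewrite sumEFin -EFinM; exact: ltry.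
Qed.

End finite_support.

(** * Empirical measures on spaces of functions *)

Section empirical_measure.
Context (R : realType) (T : Type) (sigma : R -> R).
Implicit Types (U : set (T -> R)) (N : (T -> R) -> R).

Definition separating U N :=
  forall f g, U f -> U g -> f <> g -> 0 < N (f \- g).

(** The complement of [[set f]] is open: around [g] in [U], the ball of radius [N (f \- g)] misses
    [f]. *)
Lemma measurable_set1_funs_on U N (f : T -> R) : separating U N ->
  measurable ([set f] : set (funs_on U N)).
Proof.
move=> sep; rewrite -[X in measurable X]setCK; apply: measurableC.
apply: sub_sigma_algebra => g /= gf Ug.
have [Uf|nUf] := pselect (U f).
  exists (N (f \- g)); first by apply: sep => // fg; apply: gf.
  by move=> k Uk + kf; rewrite kf ltxx.
(* With [f] outside [U], the complement of the point contains all of [U], so any radius works. *)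
by exists 1 => // k Uk _ kf; apply: nUf; rewrite -kf.
Qed.

Context (m : nat) (h : 'I_m -> T -> R).

Definition empirical_kernel (x x' : T) : R :=
  m%:R^-1 * \sum_(i < m) sigma (h i x) * sigma (h i x').

Let m_ge0 : 0 <= m%:R^-1 :> R. Proof. by rewrite invr_ge0. Qed.

Lemma ladder_kernel_empirical U N : separating U N ->
  ladder_kernel sigma (empirical U N h) = empirical_kernel.
Proof.
move=> sep; apply/funext => x; apply/funext => x'.
rewrite /ladder_kernel /Rintegral.
rewrite (@integral_atoms _ _ _ (empirical U N h) m h m%:R^-1 m_ge0)//.
by move=> i; exact: measurable_set1_funs_on.
Qed.

Lemma ladder_kernel_finite_empirical U N : separating U N ->
  ladder_kernel_finite sigma (empirical U N h).
Proof.
move=> sep x x'.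
apply: (@ae_integrable_atoms _ _ _ (empirical U N h) m h m%:R^-1 m_ge0) => //.
by move=> i; exact: measurable_set1_funs_on.
Qed.

(** The kernel on the right does not mention [U] and [N]. This allows passing from empirical
    measures on the continuous functions to those on the RKHS of each level. *)
Lemma is_ladder_rkhs_empirical U N (H : rkhs R T) : separating U N ->
  is_ladder_rkhs sigma (empirical U N h) H <-> has_kernel H empirical_kernel.
Proof.
move=> sep; rewrite /is_ladder_rkhs ladder_kernel_empirical//.
split=> [[]//|?]; split => //; exact: ladder_kernel_finite_empirical.
Qed.

Lemma fun_prob_empirical U N : (0 < m)%N -> (forall i, U (h i)) ->
  fun_prob U N (empirical U N h).
Proof.
move=> m0 Uh; split; rewrite /= /empirical.
  rewrite (eq_bigr (fun=> 1%:E)); last by move=> i _; rewrite diracT.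
  rewrite sumEFin big_const_ord iter_addr_0 -EFinM mulVf// pnatr_eq0 -lt0n//.
rewrite big1 ?mule0// => i _.
by rewrite diracE memNset//= => /(_ (Uh i)).
Qed.

Lemma separating_rkhs (H : rkhs R T) : separating H (rkhs_norm H).
Proof.
move=> f g Hf Hg fg.
have Hfg : rkhs_fun H (f \- g).
  rewrite (_ : f \- g = fun x => -1 * g x + f x); first exact: rkhs_lin.
  by apply/funext => x /=; rewrite mulN1r addrC.
rewrite sqrtr_gt0 lt_neqAle rkhs_ip_ge0// andbT eq_sym.
apply/eqP => /(rkhs_ip_eq0 Hfg) fg0; apply: fg; apply/funext => x.
by have /eqP := congr1 (@^~ x) fg0; rewrite /= subr_eq0 => /eqP.
Qed.

Lemma rkhs_pnorm_empirical_le (p : \bar R) (H : rkhs R T) (v : 'I_m -> R) :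
  (0 < m)%N -> (0 < p)%E -> (forall i, rkhs_norm H (h i) <= v i) ->
  (rkhs_pnorm p (empirical H (rkhs_norm H) h) <= (pmean p v)%:E)%E.
Proof.
move=> m0 p0 hv.
have mh i : measurable ([set h i] : set (funs_on H (rkhs_norm H))).
  by apply: measurable_set1_funs_on; exact: separating_rkhs.
rewrite /rkhs_pnorm unlock; case: p p0 => [r|_|//].
  rewrite lte_fin => r0 /=.
  have /= E := integral_atoms (mu := empirical H (rkhs_norm H) h) m_ge0
    (fun=> erefl) mh (fun f => `|rkhs_norm H f| `^ r).
  rewrite [X in (X `^ _)%E]E.
  rewrite poweR_EFin lee_fin; apply: ge0_ler_powR.
  - by rewrite invr_ge0 ltW.
  - by rewrite nnegrE mulr_ge0// sumr_ge0// => i _; exact: powR_ge0.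
  - by rewrite nnegrE mulr_ge0// sumr_ge0// => i _; exact: powR_ge0.
  apply: ler_wpM2l => //; apply: ler_sum => i _.
  rewrite ger0_norm ?sqrtr_ge0//; apply: ge0_ler_powR => //.
  - exact: ltW.
  - by rewrite nnegrE sqrtr_ge0.
  - by rewrite nnegrE (le_trans _ (hv i))// sqrtr_ge0.
(* In the branch where the infinity-norm takes its default value 0, the bound holds because the
   maximum in [pmean] starts from 0. *)
case: ifP => [_|_]; last first.
  by rewrite lee_fin bigmax_ge_id.
apply/ess_supP; apply: (atoms_ae (mu := empirical H (rkhs_norm H) h) _ mh) => //= i.
rewrite lee_fin ger0_norm ?sqrtr_ge0//.
exact: le_trans (hv i) (le_bigmax _ _ _).
Qed.

End empirical_measure.

(** * The RKHS of a finite-dimensional feature map *)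

Section dot_product.
Context (R : realType) (n : nat).
Implicit Types u v w : 'rV[R]_n.

Lemma dotvC u v : dotv u v = dotv v u.
Proof. by apply: eq_bigr => k _; rewrite mulrC. Qed.

Lemma dotv_linl (c : R) u v w : dotv (c *: u + v) w = c * dotv u w + dotv v w.
Proof.
by rewrite mulr_sumr -big_split; apply: eq_bigr => k _; rewrite !mxE mulrDl mulrA.
Qed.

Lemma dotv_linr (c : R) u v w : dotv w (c *: u + v) = c * dotv w u + dotv w v.
Proof. by rewrite dotvC dotv_linl !(dotvC w). Qed.

Lemma dotvDl u v w : dotv (u + v) w = dotv u w + dotv v w.
Proof. by rewrite -[u]scale1r dotv_linl mul1r scale1r. Qed.

Lemma dotvDr u v w : dotv w (u + v) = dotv w u + dotv w v.
Proof. by rewrite dotvC dotvDl !(dotvC w). Qed.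

Lemma dotv0 u : dotv u 0 = 0.
Proof. by rewrite /dotv big1// => k _; rewrite mxE mulr0. Qed.

Lemma dotvBl u v w : dotv (u - v) w = dotv u w - dotv v w.
Proof. by rewrite addrC -scaleN1r dotv_linl mulN1r addrC. Qed.

Lemma dotv_mulmx u v : dotv u v = (u *m v^T) 0 0.
Proof. by rewrite mxE; apply: eq_bigr => k _; rewrite !mxE. Qed.

Lemma dotv_ge0 u : 0 <= dotv u u.
Proof. by apply: sumr_ge0 => k _; rewrite -expr2 sqr_ge0. Qed.

Lemma dotv_eq0 u : dotv u u = 0 -> u = 0.
Proof.
move=> /psumr_eq0P u0; apply/rowP => k; rewrite mxE; apply/eqP.
by rewrite -sqrf_eq0 expr2 u0// => j _; rewrite -expr2 sqr_ge0.
Qed.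

Lemma le_norm2_coord u k : `|u 0 k| <= norm2 u.
Proof.
rewrite -sqrtr_sqr; apply: ler_wsqrtr; rewrite /dotv (bigD1 k)//= expr2 lerDl.
by apply: sumr_ge0 => j _; rewrite -expr2 sqr_ge0.
Qed.

Lemma norm2_cvg0 (u : nat -> 'rV[R]_n) :
  (forall k, u i 0 k @[i --> \oo] --> (0 : R)) ->
  norm2 (u i) @[i --> \oo] --> (0 : R).
Proof.
move=> u0; rewrite -(@sqrtr0 R).
apply: (@continuous_cvg _ _ _ (nbhs \oo) _ (fun i => dotv (u i) (u i)) Num.sqrt).
  exact: sqrt_continuous.
rewrite (_ : 0 = \sum_(k < n) (0 * 0 : R)); last first.
  by rewrite big1// => k _; rewrite mulr0.
apply: cvg_big => [|k _]; first exact: add_continuous.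
by apply: cvgM; exact: u0.
Qed.

(** Completeness is inherited from the reals coordinate by coordinate, each coordinate being
    dominated by the norm. *)
Lemma norm2_cauchy_cvg (u : nat -> 'rV[R]_n) :
  (forall e, 0 < e -> exists N, forall i j, (N <= i)%N -> (N <= j)%N ->
    norm2 (u i - u j) < e) ->
  exists v, norm2 (u i - v) @[i --> \oo] --> (0 : R).
Proof.
move=> uC.
have cvgu k : cvg (u i 0 k @[i --> \oo]).
  apply/cauchy_cvgP/cauchy_exP => e e0; have [N uN] := uC e e0.
  exists (u N 0 k); exists N => // i /= Ni; rewrite /ball /=.
  apply: le_lt_trans (uN N i (leqnn N) Ni).
  by have := le_norm2_coord (u N - u i) k; rewrite !mxE.
exists (\row_k lim (u i 0 k @[i --> \oo])); apply: norm2_cvg0 => k.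
pose l := lim (u i 0 k @[i --> \oo]).
rewrite (_ : (fun i => _) = (fun i => u i 0 k) \- cst l); last first.
  by apply/funext => i; rewrite !mxE.
by rewrite -(subrr l); apply: cvgB; [exact: cvgu|exact: cvg_cst].
Qed.

End dot_product.

(** * Linear spans and orthogonal projection *)

Section linear_span.
Context (R : realType) (n : nat) (A : set 'rV[R]_n).
Implicit Types u v w : 'rV[R]_n.

(* Closure under linear combinations without bases: [A] may be infinite, and
   the definition is its own induction principle. *)
Definition linear_span : set 'rV[R]_n :=
  [set v | forall P : set 'rV[R]_n, P 0 ->
    (forall c u w, P u -> P w -> P (c *: u + w)) -> A `<=` P -> P v].

Lemma linear_span0 : linear_span 0. Proof. by []. Qed.

Lemma linear_span_lin c u w :
  linear_span u -> linear_span w -> linear_span (c *: u + w).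
Proof. by move=> Su Sw P P0 Plin AP; apply: (Plin); [exact: Su|exact: Sw]. Qed.

Lemma linear_span_sub : A `<=` linear_span.
Proof. by move=> v Av P _ _; apply. Qed.

Lemma linear_spanZ c u : linear_span u -> linear_span (c *: u).
Proof. by move=> Su; rewrite -[_ *: _]addr0; apply: linear_span_lin. Qed.

Lemma linear_spanD u w : linear_span u -> linear_span w -> linear_span (u + w).
Proof. by move=> Su; rewrite -[u]scale1r; apply: linear_span_lin. Qed.

Lemma linear_spanB u w : linear_span u -> linear_span w -> linear_span (u - w).
Proof. by move=> Su Sw; rewrite -scaleN1r addrC; apply: linear_span_lin. Qed.

(* Take for [B] a matrix of maximal rank with rows in the span. *)
Lemma linear_span_mx : exists B : 'M[R]_n, forall v, linear_span v <-> (v <= B)%MS.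
Proof.
pose Q r := `[< exists B : 'M[R]_n,
  \rank B = r /\ forall v, (v <= B)%MS -> linear_span v >].
have Q0 : exists r, Q r.
  exists 0%N; apply/asboolP; exists 0; rewrite mxrank0; split => // v.
  by rewrite submx0 => /eqP ->; exact: linear_span0.
have Qn r : Q r -> (r <= n)%N.
  by move=> /asboolP[B [<- _]]; exact: rank_leq_row.
have [_ /asboolP[B [<- BS]] maxB] := ex_maxnP Q0 Qn.
exists B => v; split=> [Sv|/BS//].
(* Adding [v] keeps the row space inside the span, so by maximality the rank does not grow and [v]
   already lies in the row space of [B]. *)
have le_rank : (\rank (B + v)%MS <= \rank B)%N.
  apply: maxB; apply/asboolP; exists (B + v)%MS; split=> // w.
  move=> /sub_addsmxP[[u1 u2] /= ->]; apply: linear_spanD.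
    by apply: BS; exact: submxMl.
  by rewrite [u2]mx11_scalar mul_scalar_mx; exact: linear_spanZ.
apply: submx_trans (addsmxSr B v) _.
by rewrite -(mxrank_leqif_sup (addsmxSl B v)) eqn_leq le_rank mxrankS ?addsmxSl.
Qed.

(** Orthogonal projection by the normal equations: a solution [D] of [w *m B^T = D *m (B *m B^T)]
    makes [w - D *m B] orthogonal to the rows of [B]. *)
Lemma linear_span_proj w :
  exists2 v, linear_span v & forall u, linear_span u -> dotv (w - v) u = 0.
Proof.
have [B BS] := linear_span_mx.
(* [v B B^T = 0] implies [|v B|^2 = 0], so [B B^T] and [B^T] have the same rank. *)
have BBK : (B^T <= B *m B^T)%MS.
  have kerE : (kermx (B *m B^T) <= kermx B)%MS.
    apply/rV_subP => v /sub_kermxP; rewrite mulmxA => vBB; apply/sub_kermxP.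
    apply: dotv_eq0; rewrite dotv_mulmx trmx_mul mulmxA vBB mul0mx mxE//.
  have := mxrankS kerE; rewrite !mxrank_ker => le_ker.
  rewrite -(mxrank_leqif_sup (submxMl _ _)) eqn_leq mxrank_tr.
  rewrite (leq_trans (mxrankM_maxl _ _))//=.
  by rewrite -(leq_sub2lE _ (rank_leq_row B)).
have /submxP[D wD] : (w *m B^T <= B *m B^T)%MS by rewrite (submx_trans (submxMl _ _)).
exists (D *m B); first by apply/BS; exact: submxMl.
move=> u /BS /submxP[E ->].
by rewrite dotv_mulmx trmx_mul mulmxA mulmxBl wD -mulmxA subrr mul0mx mxE.
Qed.

End linear_span.

(** * The functions given by a feature map and their Hilbert structure *)

Section feature_rkhs.
Context (R : realType) (T : Type) (n : nat) (Phi : T -> 'rV[R]_n).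
Implicit Types v w : 'rV[R]_n.

Definition feature w : T -> R := fun x => dotv w (Phi x).

Definition feature_kernel (x x' : T) : R := dotv (Phi x) (Phi x').

Let S := linear_span (range Phi).

(** The part of [w] orthogonal to the span pairs to 0 with every [Phi x], so dropping it keeps the
    function; the norm decreases by Pythagoras. *)
Lemma feature_span_proj w :
  exists v, [/\ S v, feature v = feature w & norm2 v <= norm2 w].
Proof.
have [v Sv wv] := linear_span_proj (range Phi) w; exists v; split => //.
  apply/funext => x; apply/esym/eqP; rewrite -subr_eq0 -dotvBl wv//.
  by apply: linear_span_sub; exists x.
apply: ler_wsqrtr; rewrite -{1 2}(subrK v w); move: (w - v) wv => e wv.
by rewrite dotvDl !dotvDr (dotvC v e) (wv _ Sv) addr0 add0r lerDr dotv_ge0.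
Qed.

Lemma feature_span_inj v w : S v -> S w -> feature v = feature w -> v = w.
Proof.
move=> Sv Sw fvw; apply/eqP; rewrite -subr_eq0; apply/eqP/dotv_eq0.
(* [v - w] is orthogonal to every generator, hence to the whole span, hence to itself. *)
apply: (linear_spanB Sv Sw (P := [set u | dotv (v - w) u = 0])) => /=.
- exact: dotv0.
- by move=> c u u' /= u0 u'0; rewrite dotv_linr u0 u'0 mulr0 addr0.
- by move=> _ [x _ <-] /=; rewrite dotvBl -/(feature _ _) fvw subrr.
Qed.

(** This holds for any [H] with the kernel, without appeal to uniqueness: the reproducing property
    fixes the inner products with the generators [Phi x], and linearity extends them to the span,
    where [H] carries the dot product. *)
Lemma has_kernel_feature (H : rkhs R T) : has_kernel H feature_kernel ->
  forall w, rkhs_fun H (feature w) /\ rkhs_norm H (feature w) <= norm2 w.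
Proof.
move=> [HK repr] w; have [v [Sv <- le_vw]] := feature_span_proj w.
have featureD c u u' : feature (c *: u + u') = fun x => c * feature u x + feature u' x.
  by apply/funext => x; rewrite /feature dotv_linl.
have feature0 : feature 0 = fun=> 0.
  by apply/funext => x; rewrite /feature dotvC dotv0.
have HS u : S u -> rkhs_fun H (feature u).
  move=> Su; apply: (Su [set u | rkhs_fun H (feature u)]) => /=.
  - by rewrite feature0; exact: rkhs_zero.
  - by move=> c u1 u2 H1 H2; rewrite featureD; exact: rkhs_lin.
  - by move=> _ [x _ <-]; exact: HK.
have ipS u : S u -> rkhs_ip H (feature v) (feature u) = dotv v u.
  move=> Su.
  (* Membership is carried through the induction because [rkhs_ip] is linear only on functions of
     [H]. *)
  suff [] : rkhs_fun H (feature u) /\ rkhs_ip H (feature u) (feature v) = dotv u v.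
    by move=> Hu; rewrite rkhs_ipC 1?dotvC//; exact: HS.
  apply: (Su [set u | rkhs_fun H (feature u) /\
    rkhs_ip H (feature u) (feature v) = dotv u v]).
  - split; first exact: HS.
    (* The product with the zero function vanishes since linearity gives [t = t + t] for it. *)
    have := rkhs_ip_lin 1 (rkhs_zero H) (rkhs_zero H) (HS _ Sv).
    rewrite (_ : (fun _ => _) = fun=> 0); last first.
      by apply/funext => x; rewrite mulr0 addr0.
    rewrite -feature0 mul1r => /eqP.
    by rewrite -subr_eq subrr => /eqP <-; rewrite dotvC dotv0.
  - move=> c u1 u2 [H1 E1] [H2 E2]; split; rewrite featureD; first exact: rkhs_lin.
    by rewrite rkhs_ip_lin ?E1 ?E2 ?dotv_linl//; exact: HS.
  - move=> _ [x _ <-]; split; first exact: HK.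
    rewrite rkhs_ipC; [|exact: HK|exact: HS].
    by rewrite dotvC; apply/esym/repr; exact: HS.
split; first exact: HS.
by rewrite /rkhs_norm ipS.
Qed.

(* The representative of least norm; it is unique, being in the span. *)
Definition feature_repr (f : T -> R) : 'rV[R]_n :=
  xget 0 [set v | S v /\ feature v = f].

Lemma feature_reprP w :
  S (feature_repr (feature w)) /\ feature (feature_repr (feature w)) = feature w.
Proof.
have [v [Sv vw _]] := feature_span_proj w.
exact: (xgetI 0 (conj Sv vw : [set v | S v /\ feature v = feature w] v)).
Qed.

Lemma feature_repr_eq v : S v -> feature_repr (feature v) = v.
Proof. by move=> Sv; have [Sr] := feature_reprP v; exact: feature_span_inj. Qed.

Lemma feature_lin c v w :
  (fun x => c * feature v x + feature w x) = feature (c *: v + w).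
Proof. by apply/funext => x; rewrite /feature dotv_linl. Qed.

Lemma feature_repr_lin c v w :
  feature_repr (fun x => c * feature v x + feature w x) =
  c *: feature_repr (feature v) + feature_repr (feature w).
Proof.
have [Sv {1}<-] := feature_reprP v; have [Sw {1}<-] := feature_reprP w.
by rewrite feature_lin feature_repr_eq//; exact: linear_span_lin.
Qed.

Lemma le_norm2_feature_repr w : norm2 (feature_repr (feature w)) <= norm2 w.
Proof.
have [v [Sv <- le_vw]] := feature_span_proj w.
by rewrite feature_repr_eq.
Qed.

(** The inner product that makes [feature] an isometry from the span of the [Phi x] onto the space
    of functions. *)
Definition feature_ip f g := dotv (feature_repr f) (feature_repr g).

Lemma feature_rkhs_zero : range feature (fun=> 0).
Proof. by exists 0 => //; apply/funext => x; rewrite /feature dotvC dotv0. Qed.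

Lemma feature_rkhs_lin (c : R) f g : range feature f -> range feature g ->
  range feature (fun x => c * f x + g x).
Proof. by move=> [v _ <-] [w _ <-]; rewrite feature_lin; exists (c *: v + w). Qed.

Lemma feature_ipC f g : range feature f -> range feature g ->
  feature_ip f g = feature_ip g f.
Proof. by move=> _ _; exact: dotvC. Qed.

Lemma feature_ip_lin (c : R) f g k :
  range feature f -> range feature g -> range feature k ->
  feature_ip (fun x => c * f x + g x) k = c * feature_ip f k + feature_ip g k.
Proof.
by move=> [v _ <-] [w _ <-] _; rewrite /feature_ip feature_repr_lin dotv_linl.
Qed.

Lemma feature_ip_ge0 f : range feature f -> 0 <= feature_ip f f.
Proof. by move=> _; exact: dotv_ge0. Qed.

Lemma feature_ip_eq0 f : range feature f -> feature_ip f f = 0 -> f = (fun=> 0).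
Proof.
move=> [v _ <-] /dotv_eq0 r0; have [_ <-] := feature_reprP v; rewrite r0.
by apply/funext => x; rewrite /feature dotvC dotv0.
Qed.

Lemma featureB v w : feature v \- feature w = feature (v - w).
Proof. by apply/funext => x; rewrite /feature dotvBl. Qed.

Lemma feature_rkhs_complete (u : nat -> T -> R) :
  (forall i, range feature (u i)) ->
  (forall e : R, 0 < e -> exists N : nat, forall i k : nat,
     (N <= i)%N -> (N <= k)%N ->
     Num.sqrt (feature_ip (u i \- u k) (u i \- u k)) < e) ->
  exists2 f, range feature f &
    Num.sqrt (feature_ip (u i \- f) (u i \- f)) @[i --> \oo] --> (0 : R).
Proof.
move=> Fu uC; pose r i := feature_repr (u i).
have rP i : S (r i) /\ feature (r i) = u i.
  by rewrite /r; have [w _ <-] := Fu i; exact: feature_reprP.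
have [v rv] : exists v, norm2 (r i - v) @[i --> \oo] --> (0 : R).
  apply: norm2_cauchy_cvg => e /uC[N uN]; exists N => i j Ni Nj.
  have [[Si ri] [Sj rj]] := (rP i, rP j).
  move: (uN i j Ni Nj); rewrite /feature_ip -ri -rj featureB feature_repr_eq//.
  exact: linear_spanB.
exists (feature v); first by exists v.
(* The difference of functions is represented by [r i - v], and its least representative is no
   longer than that. *)
apply: (squeeze_cvgr _ (cvg_cst 0) rv); apply: nearW => i.
rewrite sqrtr_ge0 /=; have [_ <-] := rP i.
by rewrite featureB; exact: le_norm2_feature_repr.
Qed.

Lemma feature_rkhs_eval (x : T) : exists c : R, forall f, range feature f ->
  `|f x| <= c * Num.sqrt (feature_ip f f).
Proof.
(* The constant is the l1-norm of [Phi x]: each coordinate of the representative is at most its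
   Euclidean norm. *)
exists (\sum_(k < n) `|Phi x 0 k|) => _ [v _ <-].
have [_ {1}<-] := feature_reprP v; rewrite mulr_suml.
apply: le_trans (ler_norm_sum _ _ _) _; apply: ler_sum => k _.
by rewrite normrM mulrC; apply: ler_wpM2l => //; exact: le_norm2_coord.
Qed.

Definition feature_rkhs : rkhs R T :=
  Rkhs feature_rkhs_zero feature_rkhs_lin feature_ipC feature_ip_lin
    feature_ip_ge0 feature_ip_eq0 feature_rkhs_complete feature_rkhs_eval.

Lemma feature_rkhs_kernel : has_kernel feature_rkhs feature_kernel.
Proof.
split=> [x|f x [v _ <-]]; first by exists (Phi x).
rewrite /= /feature_ip (_ : feature_kernel x = feature (Phi x)); last by [].
rewrite (feature_repr_eq (v := Phi x)); last by apply: linear_span_sub; exists x.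
by have [_ {1}<-] := feature_reprP v.
Qed.

End feature_rkhs.

(** * The ladder of a network *)

Section continuous_functions.
Context (R : realType) (d : nat) (X : set 'rV[R]_d).

Lemma cont_funs_bounded (f : X -> R) : compact X -> continuous f ->
  has_ubound (range (fun x => `|f x|)).
Proof.
move=> cX cf.
(* Compactness is a property of the subset [X], so [f] is extended by 0 to the whole space. *)
have cF : {within X, continuous (valL_ 0 f)} by apply/subspace_valL_continuousP'.
have [M [_ MP]] := compact_bounded (continuous_compact cF cX).
(* [compact_bounded] provides a bound by every number strictly above [M]. *)
exists (M + 1) => _ [x _ <-]; apply: MP; first by rewrite ltrDl.
exists (set_val x); first exact: set_valP.
by have /(congr1 (@^~ x)) := valLK 0 f.
Qed.

(** The sup-norm dominates the difference at a point where [f] and [g] disagree; compactness bounds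
    the range, so that [sup] is a true supremum. *)
Lemma separating_cont_funs : compact X -> separating (cont_funs X) sup_norm.
Proof.
move=> cX f g cf cg fg.
have [x fgx] : exists x, f x <> g x.
  by apply/existsNP => fg'; apply: fg; apply/funext.
have cfg : continuous (f \- g) by move=> y; exact: cvgB (cf y) (cg y).
apply: (@lt_le_trans _ _ `|(f \- g) x|).
  by rewrite normr_gt0 subr_eq0; exact/eqP.
by apply: ub_le_sup; [exact: cont_funs_bounded|exists x].
Qed.

Lemma lin_comb_continuous (T : topologicalType) n (c : 'I_n -> R)
    (g : 'I_n -> T -> R) : (forall j, continuous (g j)) ->
  continuous (fun x => \sum_(j < n) c j * g j x).
Proof.
move=> cg; apply: continuous_big => [|j _ x]; first exact: add_continuous.
by apply: continuousM; [exact: cst_continuous|exact: cg].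
Qed.

Lemma dotv_continuous (z : 'rV[R]_d) : continuous (fun x : X => dotv z (set_val x)).
Proof.
apply: lin_comb_continuous => k x.
apply: (@continuous_comp _ _ _ (@set_val _ X) (fun v : 'rV[R]_d => v 0 k)).
  exact: initial_continuous.
exact: coord_continuous.
Qed.

Lemma preact_continuous (sigma : R -> R) m (z : 'I_m -> 'rV[R]_d) W l i :
  continuous sigma -> continuous (preact sigma z W l i : X -> R).
Proof.
move=> cs; elim: l i => [|l IH] i; first exact: cst_continuous.
rewrite /preact -/preact; case: (l == 0%N); first exact: dotv_continuous.
have cg := lin_comb_continuous (c := W l i)
  (fun j x => continuous_comp (IH j x) (cs (preact sigma z W l j x))).
by move=> x; exact: (continuousM (@cst_continuous X R m%:R^-1 x) (cg x)).
Qed.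

End continuous_functions.

(** * Weighted averages of activations in the RKHS of an empirical measure *)

Section empirical_rkhs.
Context (R : realType) (T : Type) (sigma : R -> R) (m : nat) (h : 'I_m -> T -> R).

Definition activation_feature (x : T) : 'rV[R]_m :=
  \row_i (Num.sqrt m%:R^-1 * sigma (h i x)).

Lemma sqrt_width_mul (a b : R) :
  (Num.sqrt m%:R^-1 * a) * (Num.sqrt m%:R^-1 * b) = m%:R^-1 * (a * b).
Proof. by rewrite mulrACA -expr2 sqr_sqrtr ?invr_ge0. Qed.

Lemma feature_kernel_activation :
  feature_kernel activation_feature = empirical_kernel sigma h.
Proof.
apply/funext => x; apply/funext => x'.
rewrite /empirical_kernel mulr_sumr; apply: eq_bigr => i _.
by rewrite !mxE sqrt_width_mul.
Qed.

Lemma has_kernel_empirical (H : rkhs R T) (w : 'I_m -> R) :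
  has_kernel H (empirical_kernel sigma h) ->
  let f x := m%:R^-1 * \sum_(i < m) w i * sigma (h i x) in
  rkhs_fun H f /\
  rkhs_norm H f <= Num.sqrt (m%:R^-1 * \sum_(i < m) w i ^+ 2).
Proof.
rewrite -feature_kernel_activation => HK f.
(* The weights get the same factor [m^(-1/2)] as the features: the pairing then has factor [1/m],
   and the norm is the root mean square of the weights. *)
have := has_kernel_feature HK (\row_i (Num.sqrt m%:R^-1 * w i)).
rewrite (_ : feature _ _ = f); last first.
  apply/funext => x; rewrite /f mulr_sumr; apply: eq_bigr => i _.
  by rewrite !mxE sqrt_width_mul.
rewrite (_ : norm2 _ = Num.sqrt (m%:R^-1 * \sum_(i < m) w i ^+ 2))//.
congr Num.sqrt; rewrite mulr_sumr; apply: eq_bigr => i _.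
by rewrite !mxE sqrt_width_mul.
Qed.

End empirical_rkhs.

(** * Norms and complexity along the ladder of a network *)

Section network_ladder.
Context (R : realType) (d : nat) (X : set 'rV[R]_d) (sigma : R -> R).
Context (L m : nat) (z : 'I_m -> 'rV[R]_d) (W : nat -> 'I_m -> 'I_m -> R).
Context (a : 'I_m -> R).
Hypotheses (cX : compact X) (L_ge2 : (2 <= L)%N) (m_gt0 : (0 < m)%N).
Let f : X -> R := network sigma L z W a.
Let h := preact (X := X) sigma z W.

Lemma is_network_ladderP (Hs : nat -> rkhs R X) :
  is_network_ladder sigma L z W Hs <->
  is_linear_rkhs (Hs 1%N) /\
  forall l, (1 <= l < L)%N -> has_kernel (Hs l.+1) (empirical_kernel sigma (h l)).
Proof.
have sep := separating_cont_funs cX.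
split=> -[H1 HS]; split => // l lL.
  by have /(is_ladder_rkhs_empirical _ _ _ sep) := HS l lL.
by apply/(is_ladder_rkhs_empirical _ _ _ sep)/HS.
Qed.

Lemma exists_network_ladder :
  exists Hs : nat -> rkhs R X, is_network_ladder sigma L z W Hs.
Proof.
(* Level 1 takes the inclusion of [X] as feature map; level [l] above it takes the activations of
   layer [l.-1]. *)
exists (fun l => if (l <= 1)%N then feature_rkhs (@set_val _ X)
  else feature_rkhs (activation_feature sigma (h l.-1))).
apply/is_network_ladderP; split => [|[|l]//= _].
  split; last exact: feature_rkhs_kernel.
  by apply/seteqP; split => g [v] => [_ <-|->]; exists v.
by rewrite -feature_kernel_activation; exact: feature_rkhs_kernel.
Qed.

(** The contribution of one neuron, whose [p]-mean over [i] is [param_norm] at the levels below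
    [L]. *)
Definition weight_norm (l : nat) (i : 'I_m) : R :=
  if l == 1%N then norm2 (z i)
  else Num.sqrt (m%:R^-1 * \sum_(j < m) `|W l.-1 i j| ^+ 2).

Section fixed_ladder.
Context (Hs : nat -> rkhs R X) (ladder : is_network_ladder sigma L z W Hs).

Lemma network_ladder_preact l i : (1 <= l < L)%N ->
  rkhs_fun (Hs l) (h l i) /\ rkhs_norm (Hs l) (h l i) <= weight_norm l i.
Proof.
have [[_ K1] K] := (is_network_ladderP Hs).1 ladder.
case: l => [//|[_|l /andP[_ lL]]].
  exact: (has_kernel_feature (Phi := @set_val _ X) K1 (z i)).
(* The level is now [l.+2]; its functions combine the activations of layer [l.+1] with weights
   [W l.+1]. *)
have := has_kernel_empirical (W l.+1 i) (K l.+1 (ltnW lL)).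
rewrite /weight_norm /=.
by under [in X in _ -> _ /\ _ <= Num.sqrt (_ * X)]eq_bigr do rewrite real_normK ?num_real//.
Qed.

Lemma network_ladder_output : rkhs_fun (Hs L) f /\
  rkhs_norm (Hs L) f <= Num.sqrt (m%:R^-1 * \sum_(i < m) a i ^+ 2).
Proof.
have [_ K] := (is_network_ladderP Hs).1 ladder.
have L1 : (1 <= L.-1 < L)%N.
  by move: L_ge2; clear; case: L => [|[|l]]//= _; exact: ltnSn.
have := has_kernel_empirical a (K L.-1 L1).
by rewrite prednK// ltnW.
Qed.

(** The atoms are those of [empirical_level], but the measure lives on the Borel sets of the RKHS,
    as [level_dist] requires. *)
Let mu l : {measure set (funs_on (Hs l) (rkhs_norm (Hs l))) -> \bar R} :=
  empirical (Hs l) (rkhs_norm (Hs l)) (h l).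

Lemma network_ladder_mu l : (1 <= l < L)%N ->
  rkhs_prob (Hs l) (mu l) /\ is_ladder_rkhs sigma (mu l) (Hs l.+1).
Proof.
move=> lL; have [_ K] := (is_network_ladderP Hs).1 ladder; split.
  by apply: fun_prob_empirical => // i; have [] := network_ladder_preact i lL.
by apply/is_ladder_rkhs_empirical; [exact: separating_rkhs|exact: K].
Qed.

Lemma network_ladder_NHL : is_NHL sigma L Hs.
Proof.
split=> [|l lL]; first by have [] := ladder.
by have [] := network_ladder_mu lL; exists (mu l).
Qed.

Lemma level_dist_ge0 p (H H' : rkhs R X) : (0 <= level_dist sigma p H H')%E.
Proof. by apply: le_ereal_inf_tmp => _ [nu _ <-]; exact: Lnorm_ge0. Qed.

Lemma level_dist_le (p : \bar R) l : (0 < p)%E -> (1 <= l < L)%N ->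
  (level_dist sigma p (Hs l) (Hs l.+1) <= (param_norm L z W a p l)%:E)%E.
Proof.
move=> p0 lL; apply: (@le_trans _ _ (rkhs_pnorm p (mu l))).
  by apply: ereal_inf_lbound; exists (mu l) => //; exact: network_ladder_mu.
apply: (le_trans (rkhs_pnorm_empirical_le (v := weight_norm l) m_gt0 p0 _)).
  by move=> i; have [] := network_ladder_preact i lL.
rewrite /param_norm /weight_norm; case: eqP => // _.
by rewrite (ltn_eqF (proj2 (andP lL))).
Qed.

End fixed_ladder.

(** The ladder of the network is a candidate in both infima; its levels and the output function are
    bounded separately and the bounds multiplied. *)
Lemma complexity_network_le (p : \bar R) : (0 < p)%E ->
  (complexity sigma L p f <=
   (\prod_(1 <= l < L.+1) param_norm L z W a p l)%:E)%E.
Proof.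
move=> p0; have [Hs ladder] := exists_network_ladder.
pose D l := level_dist sigma p (Hs l) (Hs l.+1).
have D_fin l : (1 <= l < L)%N -> D l \is a fin_num.
  move=> lL; rewrite ge0_fin_numE; last exact: level_dist_ge0.
  exact: le_lt_trans (level_dist_le ladder p0 lL) (ltry _).
have D_ge0 : (0 <= \prod_(1 <= l < L) D l)%E.
  by apply: prode_ge0 => l _; exact: level_dist_ge0.
have D_le : (\prod_(1 <= l < L) D l <=
    (\prod_(1 <= l < L) param_norm L z W a p l)%:E)%E.
  (* The range is moved into the predicate to have [l < L] for each factor; nonnegativity joins the
     induction because products are monotone only for nonnegative factors. *)
  rewrite -prodEFin big_nat [leRHS]big_nat.
  suff: (0 <= \prod_(1 <= l < L | (1 <= l < L)%N) D l <=
    \prod_(1 <= l < L | (1 <= l < L)%N) (param_norm L z W a p l)%:E)%E by case/andP.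
  elim/big_ind2 : _ => [|x1 x2 y1 y2 /andP[x0 xy] /andP[y0 yz]|l lL].
  - by rewrite lee01 lexx.
  - by rewrite mule_ge0//= lee_pmul.
  - by rewrite level_dist_ge0 level_dist_le.
have dist_le : (ladder_dist sigma L p (Hs L) <= \prod_(1 <= l < L) D l)%E.
  apply: ereal_inf_lbound; exists Hs => //; split => //.
  by have [] := ladder.
have dist_ge0 : (0 <= ladder_dist sigma L p (Hs L))%E.
  apply: le_ereal_inf_tmp => _ [Hs' _ <-].
  by apply: prode_ge0 => l _; exact: level_dist_ge0.
have [Hf norm_le] := network_ladder_output ladder.
apply: (@le_trans _ _ ((rkhs_norm (Hs L) f)%:E * ladder_dist sigma L p (Hs L))%E).
  apply: ereal_inf_lbound; exists (Hs L) => //; split => //.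
  rewrite ge0_fin_numE//; apply: le_lt_trans dist_le _.
  exact: le_lt_trans D_le (ltry _).
rewrite big_nat_recr ?(ltnW L_ge2)//= mulrC EFinM.
apply: lee_pmul => //; first by rewrite lee_fin sqrtr_ge0.
  (* [param_norm] tests for level 1 before level [L]; [L >= 2] ensures that the last factor is the
     norm of the output weights [a]. *)
  rewrite lee_fin /param_norm eqxx; case: eqP => [L1|//].
  by move: L_ge2; rewrite L1.
exact: le_trans D_le.
Qed.

End network_ladder.

Theorem theorem8 (R : realType) (d : nat) (X : set 'rV[R]_d) (sigma : R -> R)
    (L m : nat) (z : 'I_m -> 'rV[R]_d) (W : nat -> 'I_m -> 'I_m -> R)
    (a : 'I_m -> R) :
  compact X -> (2 <= L)%N -> (1 <= m)%N ->
  let f : X -> R := network sigma L z W a in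
  (forall p : \bar R, (2%:E <= p)%E ->
     complexity_space sigma L p f /\
     (complexity sigma L p f
        <= (\prod_(1 <= l < L.+1) param_norm L z W a p l)%:E)%E) /\
  [/\ continuous sigma ->
        forall l : nat, (1 <= l < L)%N ->
          fun_prob (cont_funs X) sup_norm (empirical_level X sigma z W l),
      exists Hs : nat -> rkhs R X, is_network_ladder sigma L z W Hs &
      forall Hs : nat -> rkhs R X, is_network_ladder sigma L z W Hs ->
        is_NHL sigma L Hs /\ rkhs_fun (Hs L) f].
Proof.
move=> cX L_ge2 m_gt0 f; split.
  move=> p p_ge2; have p_gt0 : (0 < p)%E by rewrite (lt_le_trans _ p_ge2)// lte_fin.
  have le_prod := complexity_network_le sigma z W a cX L_ge2 m_gt0 p_gt0.
  by split => //; exact: le_lt_trans le_prod (ltry _).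
split=> [csigma l _||Hs ladder].
- by apply: fun_prob_empirical => // i; exact: preact_continuous.
- exact: exists_network_ladder.
- split; first exact: network_ladder_NHL ladder.
  by have [] := network_ladder_output a cX L_ge2 ladder.
Qed.
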